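(* Let $G$ be a simple algebraic group over an algebraically closed field $K$, and let $w\in F_m$, with word map $\tilde w\colon G^m\to G$. Let $\mathcal W_w=\tilde w^{-1}(1)$ and $\mathcal T_w=(\pi\circ\tilde w)^{-1}(\pi(1))$. Then: (a) For every irreducible component $\mathcal W_w^i$ of $\mathcal W_w$ there is an irreducible component $\mathcal T_w^j$ of $\mathcal T_w$ which contains $\mathcal W_w^i$. (b) If $\mathcal W_w\neq\mathcal T_w$, then $\operatorname{Im}\tilde w$ contains a non-trivial unipotent element $u$.
   Context: $F_m$ is the free group on $x_1,\dots,x_m$; the word map is $\tilde w(g_1,\dots,g_m)=w(g_1,\dots,g_m)$. $\pi\colon G\to G/\!/G\cong T/W$ is the quotient morphism for the conjugation action of $G$ on itself, where $T$ is a maximal torus and $W$ is the Weyl group. The set $\mathcal W_w$ is the representation variety $R(\Gamma_w,G)=\operatorname{Hom}(\Gamma_w,G)$ of the one-relator group $\Gamma_w=F_m/\langle w\rangle$ ($\langle w\rangle$ denotes the normal closure of $w$). Irreducible components are taken in the Zariski topology on $G^m$. *)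

(* Defs.v *)
From HB Require Import structures.
From mathcomp Require Import all_boot all_order all_algebra.
From mathcomp Require Import boolp classical_sets.
From mathcomp Require Import topology_structure initial_topology connected.
From mathcomp Require Import mpoly.

Set Implicit Arguments.
Unset Strict Implicit.
Unset Printing Implicit Defensive.

Import GRing.Theory.

Local Open Scope classical_set_scope.
Local Open Scope ring_scope.

Section FreeGroup.
Variable m : nat.

(* [(i, false)] stands for [x_i] and [(i, true)] for its inverse. *)
Definition letter : Type := ('I_m * bool)%type.
HB.instance Definition _ := Choice.on letter.

Definition letter_inv (a : letter) : letter := (a.1, ~~ a.2).

Definition reduced (s : seq letter) : bool :=
  sorted (fun a b => b != letter_inv a) s.

Record free_group := FreeGroup {
  free_word : seq letter;
  free_wordP : reduced free_word
}.

HB.instance Definition _ := [isSub for free_word].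
HB.instance Definition _ := [Choice of free_group by <:].

(* The reduced form of [a :: s], for [s] reduced. *)
Definition push (a : letter) (s : seq letter) : seq letter :=
  if s is b :: t then if b == letter_inv a then t else a :: s else [:: a].

Lemma letter_invK : involutive letter_inv.
Proof. by case=> i b; rewrite /letter_inv /= negbK. Qed.

Lemma push_reduced a s : reduced s -> reduced (push a s).
Proof.
case: s => [//|b t] /=; case: eqP => [_ /path_sorted //|/eqP hb].
by rewrite /reduced /= hb.
Qed.

Lemma foldr_push_reduced u v : reduced v -> reduced (foldr push v u).
Proof. by move=> hv; elim: u => //= a u /push_reduced. Qed.

Lemma pushK a s : reduced s -> push (letter_inv a) (push a s) = s.
Proof.
case: s => [|b t] /=; first by rewrite letter_invK eqxx.
case: (eqVneq b (letter_inv a)) => [->|_] ht /=; last by rewrite letter_invK eqxx.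
case: t ht => [//|c t] /andP[hc _] /=.
by rewrite letter_invK in hc *; rewrite (negPf hc).
Qed.

Lemma pushVK a s : reduced s -> push a (push (letter_inv a) s) = s.
Proof. by move=> /(pushK (letter_inv a)); rewrite letter_invK. Qed.

Lemma foldr_push_id s : reduced s -> foldr push [::] s = s.
Proof.
elim: s => [//|a s IHs] hs /=; have /IHs -> : reduced s := path_sorted hs.
by case: s hs {IHs} => [//|b t] /= /andP[/negPf ->].
Qed.

Lemma foldr_push_push a u v :
  reduced v -> foldr push v (push a u) = push a (foldr push v u).
Proof.
case: u => [//|b u] hv /=; case: eqP => [->|//].
by rewrite pushVK // foldr_push_reduced.
Qed.

Lemma foldr_pushA u v w : reduced w ->
  foldr push w (foldr push v u) = foldr push (foldr push w v) u.
Proof. by move=> hw; elim: u => //= a u IHu; rewrite foldr_push_push ?IHu. Qed.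

Definition word_inv (s : seq letter) : seq letter := rev (map letter_inv s).

Lemma word_invK : involutive word_inv.
Proof.
move=> s; rewrite /word_inv map_rev revK -map_comp.
by rewrite (eq_map (g := id)) ?map_id // => a /=; rewrite letter_invK.
Qed.

Lemma word_inv_reduced s : reduced s -> reduced (word_inv s).
Proof.
move=> hs; rewrite /reduced rev_sorted sorted_map.
rewrite (eq_sorted (e' := fun a b => b != letter_inv a)) // => a b /=.
by rewrite letter_invK eq_sym.
Qed.

Lemma word_mulV u : reduced u -> foldr push u (word_inv u) = [::].
Proof.
elim: u => [//|a u IHu] hu.
have hu' : reduced u := path_sorted hu.
rewrite /word_inv /= rev_cons -cats1 foldr_cat /= letter_invK eqxx.
exact: IHu.
Qed.

Definition free_one : free_group := @FreeGroup [::] isT.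
Definition free_mul (u v : free_group) : free_group :=
  FreeGroup (foldr_push_reduced (free_word u) (free_wordP v)).
Definition free_inv (u : free_group) : free_group :=
  FreeGroup (word_inv_reduced (free_wordP u)).

Lemma free_mulA : associative free_mul.
Proof. by move=> u v w; apply: val_inj; rewrite /= foldr_pushA // free_wordP. Qed.

Lemma free_mul1 : left_id free_one free_mul.
Proof. by move=> u; apply: val_inj. Qed.

Lemma free_mulr1 : right_id free_one free_mul.
Proof. by move=> u; apply: val_inj; rewrite /= foldr_push_id ?free_wordP. Qed.

Lemma free_mulV : left_inverse free_one free_inv free_mul.
Proof. by move=> u; apply: val_inj; rewrite /= word_mulV ?free_wordP. Qed.

Lemma free_mulrV : right_inverse free_one free_inv free_mul.
Proof.
move=> u; apply: val_inj => /=.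
by have /word_mulV := word_inv_reduced (free_wordP u); rewrite word_invK.
Qed.

HB.instance Definition _ := isGroup.Build free_group
  free_mulA free_mul1 free_mulr1 free_mulV free_mulrV.

Definition free_gen (i : 'I_m) : free_group :=
  @FreeGroup [:: (i, false)] isT.

End FreeGroup.

Section WordMap.
Variables (m : nat) (G : groupType).

Definition letter_val (g : 'I_m -> G) (a : letter m) : G :=
  if a.2 then (g a.1)^-1%g else g a.1.

Definition word_map (w : free_group m) (g : 'I_m -> G) : G :=
  (\prod_(a <- free_word w) letter_val g a)%g.

(* [word_map ^~ g] is the homomorphism sending each [x_i] to [g i]. *)
Lemma word_map_gen i g : word_map (free_gen i) g = g i.
Proof. by rewrite /word_map big_seq1. Qed.

Lemma word_mapM u v g : word_map (u * v)%g g = (word_map u g * word_map v g)%g.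
Proof.
have prod_push a s : (\prod_(b <- push a s) letter_val g b =
    letter_val g a * \prod_(b <- s) letter_val g b)%g.
  case: s => [|b t] /=; first by rewrite big_cons.
  case: eqP => [->|_]; rewrite !big_cons // mulgA.
  rewrite /letter_val /=; case: a.2 => /=; last by rewrite mulgV mul1g.
  by rewrite mulVg mul1g.
rewrite /word_map /=; elim: (free_word u) => [|a s IHs] /=.
  by rewrite big_nil mul1g.
by rewrite prod_push IHs big_cons mulgA.
Qed.

End WordMap.

Section Zariski.
Variables (K : closedFieldType) (N : nat).

Definition affine_space : Type := 'rV[K]_N.
HB.instance Definition _ := Choice.on affine_space.

Definition zero_locus (S : set {mpoly K[N]}) : set affine_space :=
  [set v | forall p, S p -> p.@[v ord0] = 0].

Definition zariski_open (U : set affine_space) : Prop :=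
  exists S, U = ~` zero_locus S.

Lemma zariski_openT : zariski_open setT.
Proof.
exists [set 1]; apply/esym; rewrite -setC0; congr (~` _).
apply/seteqP; split=> // v /(_ 1 erefl).
by rewrite meval1 => /eqP; rewrite oner_eq0.
Qed.

Lemma zariski_openI : setI_closed zariski_open.
Proof.
move=> _ _ [S ->] [T ->].
exists [set r | exists p q, [/\ S p, T q & r = p * q]].
rewrite -setCU; congr (~` _); apply/seteqP; split=> v.
  by move=> [vS|vT] _ [p [q [Sp Tq ->]]]; rewrite mevalM
    ?(vS _ Sp) ?(vT _ Tq) ?mul0r ?mulr0.
move=> vST; apply: contrapT => /not_orP[/existsNP[p /not_implyP[Sp /eqP vp]]].
move=> /existsNP[q /not_implyP[Tq /eqP vq]].
have := vST _ (ex_intro _ p (ex_intro _ q (And3 Sp Tq erefl))).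
by rewrite mevalM => /eqP; rewrite mulf_eq0 (negPf vp) (negPf vq).
Qed.

Lemma zariski_open_bigU (J : Type) (f : J -> set affine_space) :
  (forall i, zariski_open (f i)) -> zariski_open (\bigcup_i f i).
Proof.
move=> /choice[S fE]; exists (\bigcup_i S i).
apply: setC_inj; rewrite setCK setC_bigcup; apply/seteqP; split=> v.
  by move=> vf p [i _ Sip]; move: (vf i I); rewrite fE setCK; apply.
by move=> vS i _; rewrite fE setCK => p Sip; apply: vS; exists i.
Qed.

HB.instance Definition _ := isOpenTopological.Build affine_space
  zariski_openT zariski_openI zariski_open_bigU.

End Zariski.

Definition irreducible_set (T : topologicalType) (A : set T) : Prop :=
  A !=set0 /\ forall Y Z : set T, closed Y -> closed Z ->
    A `<=` Y `|` Z -> A `<=` Y \/ A `<=` Z.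

Definition irreducible_component (T : topologicalType) (A C : set T) : Prop :=
  [/\ irreducible_set C, C `<=` A &
      forall D : set T, irreducible_set D -> D `<=` A -> C `<=` D -> D = C].

(* A Zariski closed subgroup of [GL_n(K)].  As [GL_n(K)] is open in the affine
   space of all matrices, its closed subsets are the traces of closed subsets
   of that space. *)
Record linear_algebraic_group (K : closedFieldType) (n : nat) :=
  LinearAlgebraicGroup {
    lag_set : set 'M[K]_n;
    lag_closed : exists2 Z : set (affine_space K (n * n)), closed Z &
      lag_set = [set A | A \in unitmx /\ Z (mxvec A)];
    lag_set1 : lag_set 1%:M;
    lag_setM : forall A B, lag_set A -> lag_set B -> lag_set (A *m B);
    lag_setV : forall A, lag_set A -> lag_set (invmx A)
  }.

Section LinearAlgebraicGroup.
Variables (K : closedFieldType) (n : nat) (G : linear_algebraic_group K n).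

Definition lag_elt : Type := {A : 'M[K]_n | A \in lag_set G}.
HB.instance Definition _ := SubChoice.on lag_elt.

Definition lag_sub (A : 'M[K]_n) (AG : lag_set G A) : lag_elt :=
  exist (fun B => B \in lag_set G) A (mem_set AG).

Lemma lag_eltP (x : lag_elt) : lag_set G (val x).
Proof. exact: set_mem (valP x). Qed.

Definition lag_one : lag_elt := lag_sub (lag_set1 G).
Definition lag_mul (x y : lag_elt) : lag_elt :=
  lag_sub (lag_setM (lag_eltP x) (lag_eltP y)).
Definition lag_inv (x : lag_elt) : lag_elt := lag_sub (lag_setV (lag_eltP x)).

Lemma lag_set_unit (A : 'M[K]_n) : lag_set G A -> A \in unitmx.
Proof. by case: (lag_closed G) => Z _ -> []. Qed.

Lemma lag_unit (x : lag_elt) : val x \in unitmx.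
Proof. exact: lag_set_unit (lag_eltP x). Qed.

Lemma lag_mulA : associative lag_mul.
Proof. by move=> x y z; apply: val_inj; rewrite /= mulmxA. Qed.

Lemma lag_mul1 : left_id lag_one lag_mul.
Proof. by move=> x; apply: val_inj; rewrite /= mul1mx. Qed.

Lemma lag_mulr1 : right_id lag_one lag_mul.
Proof. by move=> x; apply: val_inj; rewrite /= mulmx1. Qed.

Lemma lag_mulV : left_inverse lag_one lag_inv lag_mul.
Proof. by move=> x; apply: val_inj; rewrite /= mulVmx ?lag_unit. Qed.

Lemma lag_mulrV : right_inverse lag_one lag_inv lag_mul.
Proof. by move=> x; apply: val_inj; rewrite /= mulmxV ?lag_unit. Qed.

HB.instance Definition _ := isGroup.Build lag_elt
  lag_mulA lag_mul1 lag_mulr1 lag_mulV lag_mulrV.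

Definition lag_coord (x : lag_elt) : affine_space K (n * n) := mxvec (val x).

HB.instance Definition _ :=
  Topological.copy lag_elt (initial_topology lag_coord).

End LinearAlgebraicGroup.

Coercion lag_elt : linear_algebraic_group >-> Sortclass.

(* The variety [G^m].  Its Zariski topology is the one induced by the affine
   space of [m]-tuples of matrices, not the product topology. *)
Section Power.
Variables (K : closedFieldType) (n : nat) (G : linear_algebraic_group K n).
Variable m : nat.

Definition lag_pow : Type := {ffun 'I_m -> G}.
HB.instance Definition _ := Choice.on lag_pow.

Definition lag_pow_fun (g : lag_pow) : 'I_m -> G := fun i => (g : {ffun _ -> _}) i.

Definition lag_pow_coord (g : lag_pow) : affine_space K (m * (n * n)) :=
  mxvec (\matrix_(i < m) lag_coord (lag_pow_fun g i)).

HB.instance Definition _ :=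
  Topological.copy lag_pow (initial_topology lag_pow_coord).

End Power.

Coercion lag_pow_fun : lag_pow >-> Funclass.

Section SimpleGroup.
Variables (K : closedFieldType) (n : nat) (G : linear_algebraic_group K n).

Definition normal_subgroup (H : set G) : Prop :=
  [/\ H 1%g, forall x y, H x -> H y -> H (x * y)%g,
      forall x, H x -> H x^-1%g &
      forall g x, H x -> H (g * x * g^-1)%g].

(* Finite normal (hence central) subgroups are allowed: this is simplicity in
   the sense of algebraic groups, as for [SL_n]. *)
Definition simple_algebraic_group : Prop :=
  [/\ connected [set: G],
      ~ (forall x y : G, x * y = y * x)%g &
      forall H : set G, normal_subgroup H -> closed H -> connected H ->
        H = [set 1%g] \/ H = [set: G]].

Definition unipotent (u : G) : Prop :=
  exists k : nat, (val u - 1%:M) ^+ k = 0.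

End SimpleGroup.

Section ConjugationQuotient.
Variables (K : closedFieldType) (n : nat) (G : linear_algebraic_group K n).

(* The coordinate ring of [GL_n] is generated by the matrix entries and the
   inverse of the determinant, and it maps onto that of [G]. *)
Definition regular_function (f : G -> K) : Prop :=
  exists (p : {mpoly K[n * n]}) (k : nat),
    forall x : G, f x = p.@[lag_coord x ord0] / (\det (val x)) ^+ k.

Definition conj_invariant (f : G -> K) : Prop :=
  forall g x : G, f (g * x * g^-1)%g = f x.

(* The ring of invariants [K[G]^G]. *)
Definition invariant_function : Type :=
  {f : G -> K | regular_function f /\ conj_invariant f}.

(* [G//G] is the affine variety with coordinate ring [K[G]^G]; its points are
   the [K]-algebra homomorphisms from [K[G]^G] to [K]. *)
Record conj_quotient := ConjQuotient {
  quot_hom : invariant_function -> K;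
  quot_homC : forall (c : K) (f : invariant_function),
    (forall x, sval f x = c) -> quot_hom f = c;
  quot_homD : forall f1 f2 f : invariant_function,
    (forall x, sval f x = sval f1 x + sval f2 x) ->
    quot_hom f = quot_hom f1 + quot_hom f2;
  quot_homM : forall f1 f2 f : invariant_function,
    (forall x, sval f x = sval f1 x * sval f2 x) ->
    quot_hom f = quot_hom f1 * quot_hom f2
}.

(* The morphism dual to the inclusion of [K[G]^G] in [K[G]]. *)
Definition quotient_morphism (x : G) : conj_quotient :=
  @ConjQuotient (fun f => sval f x)
    (fun c f h => h x) (fun f1 f2 f h => h x) (fun f1 f2 f h => h x).

End ConjugationQuotient.

Section WordVarieties.
Variables (K : closedFieldType) (n : nat) (G : linear_algebraic_group K n).
Variables (m : nat) (w : free_group m).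

Definition word_mapG (g : lag_pow G m) : G := word_map w g.

Definition variety_W : set (lag_pow G m) := word_mapG @^-1` [set 1%g].

Definition variety_T : set (lag_pow G m) :=
  (@quotient_morphism _ _ G \o word_mapG) @^-1` [set quotient_morphism 1%g].

End WordVarieties.

Arguments word_mapG {K n} G {m} w g.
Arguments variety_W {K n} G {m} w.
Arguments variety_T {K n} G {m} w.

(* Main.v *)
Require Import Defs.
From HB Require Import structures.
From mathcomp Require Import all_boot all_order all_algebra.
From mathcomp Require Import boolp classical_sets.
From mathcomp Require Import topology_structure initial_topology connected.
From mathcomp Require Import mpoly.

Import GRing.Theory.

Local Open Scope classical_set_scope.

(** Part (a) is pure topology.  The inclusion of [variety_W] in [variety_T] is
    immediate, and in any topological space an irreducible subset of [A] lies
    in a component of [A]: the union of a chain of irreducible sets is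
    irreducible, so Zorn's lemma provides a maximal one.

    For part (b), take [g] in [variety_T] but not in [variety_W], and let
    [u <> 1] be the value of [w] at [g].  The points [u] and [1] of [G] have the
    same image in [G//G], so no invariant regular function separates them.  The
    coefficients of the characteristic polynomial are such functions, being
    polynomials in the matrix entries that are constant on conjugacy classes.
    Hence the characteristic polynomial of [u] is that of the identity matrix,
    ['X - 1] to the power [n], and the Cayley-Hamilton theorem shows that [u] is
    unipotent. *)

(** * Irreducible components *)

(** If the union meets the complements of two closed sets in members [A] and
    [B] of the chain, the larger of [A] and [B] meets both, against its
    irreducibility. *)
Lemma irreducible_bigcup (T : topologicalType) (F : set (set T)) :
  F !=set0 -> total_on F subset -> (forall A, F A -> irreducible_set A) ->
  irreducible_set (\bigcup_(A in F) A).
Proof.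
move=> [A0 FA0] chainF irrF; split.
  by have [[x A0x] _] := irrF _ FA0; exists x, A0.
move=> Y Z clY clZ FYZ; apply: contrapT => /not_orP[].
move=> /nonsubset[x [[A FA Ax] nYx]].
move=> /nonsubset[y [[B FB By] nZy]].
have [C [FC AC BC]] : exists C, [/\ F C, A `<=` C & B `<=` C].
  by have [AB|BA] := chainF _ _ FA FB; [exists B|exists A]; split=> // x.
have CYZ : C `<=` Y `|` Z by move=> z Cz; apply: FYZ; exists C.
have [_ irrC] := irrF _ FC; have [CY|CZ] := irrC Y Z clY clZ CYZ.
- exact: nYx (CY _ (AC _ Ax)).
- exact: nZy (CZ _ (BC _ By)).
Qed.

(** Zorn's lemma, irreducible sets being stable under unions of nonempty chains. *)
Lemma irreducible_component_sup (T : topologicalType) (A C : set T) :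
  irreducible_set C -> C `<=` A ->
  exists2 D, irreducible_component A D & C `<=` D.
Proof.
move=> irrC CA.
(* The union of the empty chain is empty, hence not irreducible: adding [C]
     to every member makes it admissible. *)
pose P (X : set T) := irreducible_set (C `|` X) /\ X `<=` A.
have [F FP chainF|D [[irrD DA] maxD]] := @Zorn_bigcup T P.
  split; last by move=> x [X FX Xx]; have [_] := FP _ FX; apply.
  have [->|/set0P[X0 FX0]] := eqVneq F set0; first by rewrite bigcup_set0 setU0.
  rewrite (_ : _ `|` _ = \bigcup_(Y in [set C `|` X | X in F]) Y); last first.
    rewrite bigcup_image; apply/seteqP; split=> x.
      by move=> [Cx|[X FX Xx]]; [exists X0; last left|exists X; last right].
    by move=> [X FX [Cx|Xx]]; [left|right; exists X].
  apply: irreducible_bigcup; first by exists (C `|` X0), X0.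
    move=> _ _ [X FX <-] [Y FY <-].
    by have [XY|YX] := chainF _ _ FX FY; [left|right]; apply: setUS.
  by move=> _ [X FX <-]; have [] := FP _ FX.
have maxE E : irreducible_set E -> E `<=` A -> C `|` D `<=` E -> E `<=` D.
  move=> irrE EA CDE; apply: contrapT => nED.
  apply: (maxD E).
    by split=> // x Dx; apply: CDE; right.
  by split=> //; rewrite setUidr // => x Cx; apply: CDE; left.
exists (C `|` D); last by move=> x; left.
split=> //; first by move=> x [/CA|/DA].
move=> E irrE EA CDE; apply/seteqP; split=> // x /(maxE _ irrE EA CDE).
by right.
Qed.

Local Open Scope ring_scope.

(** * Characteristic polynomials *)

Lemma char_poly_conj (R : comUnitRingType) (n : nat) (P A : 'M[R]_n) :
  P \in unitmx -> char_poly (P *m A *m invmx P) = char_poly A.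
Proof.
move=> uP; rewrite /char_poly; set Q := map_mx polyC P.
set Q' := map_mx polyC (invmx P).
have QQ' : Q *m Q' = 1%:M by rewrite -map_mxM mulmxV // map_mx1.
have -> : char_poly_mx (P *m A *m invmx P) = Q *m char_poly_mx A *m Q'.
  rewrite /char_poly_mx !map_mxM mulmxBr mulmxBl.
  by rewrite (scalar_mxC _ Q) -(mulmxA 'X%:M) QQ' mulmx1.
by rewrite !det_mulmx mulrAC -det_mulmx QQ' det1 mul1r.
Qed.

Lemma char_poly1 (R : comNzRingType) (n : nat) :
  char_poly (1%:M : 'M[R]_n) = ('X - 1) ^+ n.
Proof.
rewrite char_poly_trig ?scalar_mx_is_trig //.
rewrite (eq_bigr (fun=> 'X - 1)) ?prodr_const ?card_ord // => i _.
by rewrite mxE eqxx.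
Qed.

(** Cayley-Hamilton; size 0, where the matrices form the zero ring, is apart
    because polynomials are only evaluated at matrices of positive size. *)
Lemma char_poly1_unipotent (R : comNzRingType) (n : nat) (A : 'M[R]_n) :
  char_poly A = char_poly (1%:M : 'M[R]_n) -> (A - 1%:M) ^+ n = 0.
Proof.
rewrite char_poly1; case: n A => [|n] A chA; first exact: flatmx0.
have := Cayley_Hamilton A.
by rewrite chA rmorphXn rmorphB /= horner_mx_X rmorph1.
Qed.

(** Computing the characteristic polynomial of the matrix of indeterminates
    gives a universal polynomial for each coefficient. *)
Lemma coef_char_poly_mpoly (R : comNzRingType) (n i : nat) :
  exists p : {mpoly R[n * n]},
    forall A : 'M[R]_n, (char_poly A)`_i = p.@[mxvec A ord0].
Proof.
pose X : 'M[{mpoly R[n * n]}]_n := \matrix_(j, k) 'X_(mxvec_index j k).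
exists (char_poly X)`_i => A; rewrite -coef_map map_char_poly.
by congr ((char_poly _)`_i); apply/matrixP => j k; rewrite !mxE /= mevalXU mxvecE.
Qed.

(** * The conjugation quotient *)

(** A point of [G//G] is by definition an evaluation of the invariant regular
    functions. *)
Lemma quotient_morphism_invariant (K : closedFieldType) (n : nat)
    (G : linear_algebraic_group K n) (x y : G) (f : G -> K) :
  quotient_morphism x = quotient_morphism y ->
  regular_function f -> conj_invariant f -> f x = f y.
Proof.
move=> xy regf invf.
by have /(congr1 (@^~ (exist _ f (conj regf invf)))) := congr1 (@quot_hom _ _ _) xy.
Qed.

Lemma quotient_morphism_char_poly (K : closedFieldType) (n : nat)
    (G : linear_algebraic_group K n) (x y : G) :
  quotient_morphism x = quotient_morphism y ->
  char_poly (val x) = char_poly (val y).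
Proof.
move=> xy; apply/polyP => i.
apply: (@quotient_morphism_invariant _ _ _ _ _
  (fun z : G => (char_poly (val z))`_i) xy).
  have [p pE] := coef_char_poly_mpoly K n i.
  by exists p, 0%N => z; rewrite expr0 divr1 pE.
by move=> g z /=; rewrite char_poly_conj ?lag_unit.
Qed.

Lemma quotient_morphism_unipotent (K : closedFieldType) (n : nat)
    (G : linear_algebraic_group K n) (u : G) :
  quotient_morphism u = quotient_morphism 1%g -> unipotent u.
Proof.
move=> /quotient_morphism_char_poly chu.
by exists n; apply: char_poly1_unipotent.
Qed.

(** * Fibres of the word map *)

Lemma variety_W_subT (K : closedFieldType) (n : nat)
    (G : linear_algebraic_group K n) (m : nat) (w : free_group m) :
  variety_W G w `<=` variety_T G w.
Proof. by move=> g; rewrite /variety_W /variety_T /= => ->. Qed.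

Local Close Scope ring_scope.

Theorem proposition3p3 (K : closedFieldType) (n : nat)
    (G : linear_algebraic_group K n) (hG : simple_algebraic_group G)
    (m : nat) (w : free_group m) :
  (forall Wi : set (lag_pow G m), irreducible_component (variety_W G w) Wi ->
     exists2 Tj : set (lag_pow G m),
       irreducible_component (variety_T G w) Tj & Wi `<=` Tj) /\
  (variety_W G w <> variety_T G w ->
     exists u : G, [/\ range (word_mapG G w) u, u <> 1%g & unipotent u]).
Proof.
split=> [Wi [irrW WiW _]|neqWT].
  apply: irreducible_component_sup => //.
  by apply: (subset_trans WiW); apply: variety_W_subT.
have [g Tg nWg] : exists2 g, variety_T G w g & ~ variety_W G w g.
  apply: contrapT => nTW; apply: neqWT; apply/seteqP; split.
    exact: variety_W_subT.
  by move=> g Tg; apply: contrapT => nWg; apply: nTW; exists g.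
exists (word_mapG G w g); split=> //.
exact: quotient_morphism_unipotent.
Qed.
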